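(* Let $\mathcal{G}$ be the set of paths $P\in\mathcal{E}$ such that either (i) $P=(UD)^k$ for some $k\ge 0$, or (ii) $P=(UD)^{\ell}U^kC_k(UD)^m$ with $\ell,m\ge 0$ and $k\ge 2$, or (iii) $P=(UD)^{\ell_0}U^{k_1}(UD)^{\ell_1}U^{k_2}(UD)^{\ell_2}\cdots U^{k_r}(UD)^{\ell_r}U^{k_{r+1}}C_s(UD)^{\ell_{r+1}}$ with $r\ge 1$, $\ell_0,\ell_{r+1}\ge 0$, $k_i\ge 1$ and $\ell_i\ge 1$ for $1\le i\le r$, $k_{r+1}\ge 0$, and $s\ge 1$ such that the path ends on the $x$-axis (with the convention $C_1=D$). The ordinary generating function $G(x)=\sum_{P\in\mathcal{G}}x^{|P|}$ of $\mathcal{G}$ with respect to the length is $$G(x)=\frac{2x^3-2x+1}{(1-x^2-x)(1-x)^2(x+1)},$$ and its series expansion is $$1+x^2+x^3+3x^4+5x^5+10x^6+17x^7+30x^8+50x^9+84x^{10}+138x^{11}+O(x^{12}).$$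
   Context: A Dyck path with catastrophes is a finite lattice path in the first quadrant ($y\ge 0$) starting at the origin, ending on the $x$-axis, with steps $U=(1,1)$, $D=(1,-1)$ and catastrophe steps $C_k=(1,-k)$, $k\ge 2$, where a catastrophe step must end on the $x$-axis (so $C_k$ can only be used from height $k$). By convention $C_1=D$. $\mathcal{E}$ is the set of all Dyck paths with catastrophes (including the empty path). The length $|P|$ is the number of steps of $P$; paths are written as words in the steps. Generating functions are formal power series in $x$. *)

(* Defs.v *)
From HB Require Import structures.
From mathcomp Require Import all_boot all_order all_algebra.
From mathcomp Require Import finmap.
From mathcomp Require Import boolp classical_sets functions cardinality.
Set Implicit Arguments.
Unset Strict Implicit.
Unset Printing Implicit Defensive.
Import Order.TTheory GRing.Theory Num.Theory.
Local Open Scope classical_set_scope.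
Local Open Scope ring_scope.

(* A formal power series is identified with its sequence of coefficients. *)
Definition fps (R : Type) := nat -> R.

Section FormalPowerSeries.
Variable R : comUnitRingType.
Implicit Types (a b : fps R) (p : {poly R}).

Definition fps_of_poly p : fps R := fun n => p`_n.

Definition fps_mul a b : fps R := fun n => \sum_(i < n.+1) a i * b (n - i)%N.

(* The first n coefficients of 1 / a, obtained by solving a * b = 1 degree by
   degree; the result is meaningful only if the constant term a 0 is a unit. *)
Fixpoint fps_inv_seq a n : seq R :=
  if n is m.+1 then
    let s := fps_inv_seq a m in
    rcons s ((a 0%N)^-1 * ((m == 0%N)%:R - \sum_(i < m) a (m - i)%N * s`_i))
  else [::].

Definition fps_inv a : fps R := fun n => (fps_inv_seq a n.+1)`_n.

Definition fps_div a b : fps R := fps_mul a (fps_inv b).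

(* a = b + O(x^n) *)
Definition fps_eq_bigO n a b := forall i, (i < n)%N -> a i = b i.

Lemma size_fps_inv_seq a n : size (fps_inv_seq a n) = n.
Proof. by elim: n => //= n IHn; rewrite size_rcons IHn. Qed.

Lemma nth_fps_inv_seq a n i : (i < n)%N -> (fps_inv_seq a n)`_i = fps_inv a i.
Proof.
elim: n => // n IHn; rewrite ltnS leq_eqVlt => /predU1P[-> //|lt_in].
by rewrite /= nth_rcons size_fps_inv_seq lt_in IHn.
Qed.

Lemma fps_mulV a : a 0%N \is a GRing.unit ->
  fps_mul a (fps_inv a) = fps_of_poly 1.
Proof.
move=> ua; apply/funext => n; rewrite /fps_mul /fps_of_poly coef1.
rewrite big_ord_recl /= subn0 {1}/fps_inv /= nth_rcons size_fps_inv_seq ltnn eqxx.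
rewrite mulrA divrr // mul1r.
rewrite (_ : \sum_(i < n) a (lift ord0 i) * _ =
             \sum_(i < n) a (n - i)%N * (fps_inv_seq a n)`_i) ?subrK //.
rewrite (reindex_inj rev_ord_inj) /=; apply: eq_bigr => i _.
by rewrite nth_fps_inv_seq // /bump /= add1n subnSK // subKn // ltnW.
Qed.

End FormalPowerSeries.

(* Steps are lattice vectors, and a path from the origin is its word of steps. *)
Definition step := (int * int)%type.
Definition lpath := seq step.

Definition U : step := (1, 1).
Definition D : step := (1, -1).
Definition C (k : nat) : step := (1, - k%:Z).

Lemma C1 : C 1 = D. Proof. by []. Qed.

(* s may be used from the lattice point p. *)
Definition valid_step (p : int * int) (s : step) : Prop :=
  0 <= (p + s).2 /\
  [\/ s = U, s = D | exists k : nat, [/\ (2 <= k)%N, s = C k & (p + s).2 = 0]].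

Fixpoint valid_from (p : int * int) (P : lpath) : Prop :=
  if P is s :: P' then valid_step p s /\ valid_from (p + s) P' else p.2 = 0.

Definition dyck_cat : set lpath := [set P | valid_from (0, 0) P].

Definition wpow (w : lpath) (n : nat) : lpath := flatten (nseq n w).

Definition UDs (n : nat) : lpath := wpow [:: U; D] n.
Definition Us (n : nat) : lpath := wpow [:: U] n.

Definition form_i (P : lpath) : Prop := exists k : nat, P = UDs k.

Definition form_ii (P : lpath) : Prop :=
  exists l m k : nat, (2 <= k)%N /\ P = UDs l ++ Us k ++ [:: C k] ++ UDs m.

(* Only the values k 1, ..., k r.+1 and l 0, ..., l r.+1 matter.  The value of s
   is determined by the fact that paths in calG end on the x-axis. *)
Definition form_iii (P : lpath) : Prop :=
  exists (r : nat) (k l : nat -> nat) (s : nat),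
    [/\ (1 <= r)%N,
        forall i, (1 <= i <= r)%N -> (1 <= k i)%N /\ (1 <= l i)%N,
        (1 <= s)%N &
        P = UDs (l 0%N)
            ++ (\big[cat/[::]]_(1 <= i < r.+1) (Us (k i) ++ UDs (l i)))
            ++ Us (k r.+1) ++ [:: C s] ++ UDs (l r.+1)].

Definition calG : set lpath :=
  [set P | dyck_cat P /\ [\/ form_i P, form_ii P | form_iii P]].

(* fset_set A is the finite set A if A is finite, and is empty otherwise; by
   finite_dyck_cat_size below the first case applies to all sets of Dyck paths
   with catastrophes. *)
Definition ogf (A : set lpath) : fps rat :=
  fun n => #|` fset_set [set P | A P /\ size P = n] |%:R.

Lemma finite_valid_from (p : int * int) (n : nat) :
  finite_set [set P | valid_from p P /\ size P = n].
Proof.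
elim: n p => [|n IHn] p.
  by apply: (@sub_finite_set _ _ [set [::]]) => // P [_ /size0nil ->].
pose S s := cons s @` [set P | valid_from (p + s) P /\ size P = n].
have finS s : finite_set (S s) by exact: finite_image.
apply: (@sub_finite_set _ _ (S U `|` (S D `|` S (C `|p.2|%N)))); last first.
  by rewrite !finite_setU; split=> //; split.
move=> [|s P] [] //= [[_ vs] vP] [sP].
case: vs => [sE|sE|[k [_ sE]]].
- by left; rewrite sE in vP *; exists P.
- by right; left; rewrite sE in vP *; exists P.
rewrite sE /= => /eqP; rewrite subr_eq0 => /eqP pk.
by right; right; rewrite pk absz_nat; rewrite sE in vP *; exists P.
Qed.

Lemma finite_dyck_cat_size (A : set lpath) (n : nat) : (A `<=` dyck_cat) ->
  finite_set [set P | A P /\ size P = n].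
Proof.
move=> AE; apply: sub_finite_set (finite_valid_from (0, 0) n).
by move=> P [/AE vP sP].
Qed.

(* Main.v *)
(* A path of type (ii) or (iii) is a power of UD, followed by a word in the
   letters U and UD that begins with UU, by a catastrophe whose size is forced
   by the height reached, and by a power of UD; this factorization is unique.
   The number t_n of completions of length n of such a path from height h >= 1
   inside the middle part does not depend on h, and t_(n+2) equals
   [n odd] + t_(n+1) + t_n.  The coefficients g_n of G satisfy
   g_(n+2) = g_n + t_n + t_(n-1).  Eliminating t gives the linear recurrence
   encoded by the denominator 1 - 2x - x^2 + 3x^3 - x^5. *)
Require Import Defs.
From mathcomp Require Import all_boot all_order all_algebra.
From mathcomp Require Import finmap.
From mathcomp Require Import boolp classical_sets cardinality.
From mathcomp Require Import zify ring.
Import Order.TTheory GRing.Theory Num.Theory.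
Local Open Scope ring_scope.

(** * Associativity and division of formal power series *)

Section FpsMul.
Variable R : comUnitRingType.
Implicit Types (a b c : fps R) (p q : {poly R}).

Definition fps_trunc n a : {poly R} := \poly_(i < n) a i.

(** Coefficients of degree below [n] depend only on the truncations, so associativity can be
    borrowed from [{poly R}]. *)
Lemma coef_fps_mul_trunc n a b i : (i < n)%N ->
  fps_mul a b i = (fps_trunc n a * fps_trunc n b)`_i.
Proof.
move=> lt_in; rewrite coefM; apply: eq_bigr => j _.
by have ltj := ltn_ord j; rewrite !coef_poly !ifT //; lia.
Qed.

Lemma fps_mulA : associative (@fps_mul R).
Proof.
move=> a b c; apply/funext => n.
transitivity ((fps_trunc n.+1 a * (fps_trunc n.+1 b * fps_trunc n.+1 c))`_n).
  rewrite coefM; apply: eq_bigr => j _.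
  by rewrite coef_poly ltn_ord (@coef_fps_mul_trunc n.+1) //; lia.
rewrite mulrA coefM; apply: eq_bigr => j _.
by rewrite (@coef_fps_mul_trunc n.+1) // coef_poly ifT //; lia.
Qed.

Lemma fps_mulr1 a : fps_mul a (fps_of_poly 1) = a.
Proof.
apply/funext => n; rewrite /fps_mul /fps_of_poly big_ord_recr /= subnn coef1.
rewrite mulr1 big1 ?add0r // => i _.
by rewrite coef1 (_ : (n - i == 0)%N = false) ?mulr0 //; have ltj := ltn_ord i; lia.
Qed.

Lemma fps_divP a b c : b 0%N \is a GRing.unit -> fps_mul a b = c -> a = fps_div c b.
Proof. by move=> ub <-; rewrite /fps_div -fps_mulA fps_mulV // fps_mulr1. Qed.

Lemma coef_fps_mul_poly a p n :
  fps_mul a (fps_of_poly p) n = (fps_trunc n.+1 a * p)`_n.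
Proof.
rewrite coefM; apply: eq_bigr => i _.
by rewrite coef_poly ltn_ord.
Qed.

End FpsMul.

(** * Recursive description of the words in [calG] *)

(* [tail h P]: from height h, P is a word in U and UD, then the catastrophe to
   the x-axis, then a power of UD. *)
Inductive tail : nat -> lpath -> Prop :=
| TailC h m : tail h (C h :: UDs m)
| TailU h P : tail h.+1 P -> tail h (U :: P)
| TailUD h P : tail h P -> tail h (U :: D :: P).

(** Requiring [UU] at the start of the middle part makes the leading power of [UD] maximal, so the
    three rules never overlap. *)
Inductive regular : lpath -> Prop :=
| RegularNil : regular [::]
| RegularUD P : regular P -> regular (U :: D :: P)
| RegularUU P : tail 1 (U :: P) -> regular (U :: U :: P).

Lemma C_neqU k : C k = U -> False.
Proof. by rewrite /C /U; case; lia. Qed.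

Lemma UDsS n : UDs n.+1 = U :: D :: UDs n. Proof. by []. Qed.
Lemma UsS n : Us n.+1 = U :: Us n. Proof. by []. Qed.

Lemma size_UDs n : size (UDs n) = n.*2.
Proof. by elim: n => // n IHn; rewrite UDsS /= IHn doubleS. Qed.

Lemma tail_Us k h P : tail (h + k) P -> tail h (Us k ++ P).
Proof.
elim: k h => [|k IHk] h; first by rewrite addn0.
by move=> tP; apply: TailU; apply: IHk; rewrite addSnnS.
Qed.

Lemma tail_UDs l h P : tail h P -> tail h (UDs l ++ P).
Proof. by move=> tP; elim: l => //= l; apply: TailUD. Qed.

Lemma tail_bigcat (I : Type) (r : seq I) (k l : I -> nat) h P :
  tail (h + \sum_(i <- r) k i) P ->
  tail h (\big[cat/[::]]_(i <- r) (Us (k i) ++ UDs (l i)) ++ P).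
Proof.
elim: r h => [|i r IHr] h; first by rewrite !big_nil addn0.
rewrite !big_cons addnA -!catA => tP.
by apply: tail_Us; apply: tail_UDs; apply: IHr.
Qed.

Lemma tail0_regular P : tail 0 (U :: U :: P) -> regular (U :: U :: P).
Proof.
by move=> tP; inversion tP; apply: RegularUU.
Qed.

Lemma regular_UDs l P : regular P -> regular (UDs l ++ P).
Proof. by move=> rP; elim: l => //= l; apply: RegularUD. Qed.

(** * Heights, and the passage from [calG] to regular words *)

Definition height (P : lpath) : int := \sum_(s <- P) s.2.

Lemma height_cat P Q : height (P ++ Q) = height P + height Q.
Proof. exact: big_cat. Qed.

Lemma height_Us k : height (Us k) = k%:Z.
Proof.
elim: k => [|k IHk]; first exact: big_nil.
by rewrite UsS /height big_cons -/(height _) IHk /= -intS.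
Qed.

Lemma height_UDs l : height (UDs l) = 0.
Proof.
elim: l => [|l IHl]; first exact: big_nil.
by rewrite UDsS /height !big_cons -/(height _) IHl.
Qed.

Lemma height_C s P : height (C s :: P) = - s%:Z + height P.
Proof. exact: big_cons. Qed.

Lemma height_bigcat (I : Type) (r : seq I) (k l : I -> nat) :
  height (\big[cat/[::]]_(i <- r) (Us (k i) ++ UDs (l i)))
  = (\sum_(i <- r) k i)%N%:Z.
Proof.
elim: r => [|i r IHr]; first by rewrite !big_nil /height big_nil.
by rewrite !big_cons !height_cat IHr height_Us height_UDs addr0 PoszD.
Qed.

Lemma valid_from_height p P : valid_from p P -> p.2 + height P = 0.
Proof.
rewrite /height; elim: P p => [|s P IHP] p /=; first by rewrite big_nil addr0.
by case=> _ /IHP; rewrite big_cons addrA.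
Qed.

Lemma calG_regular P : calG P -> regular P.
Proof.
case=> /valid_from_height /=; rewrite add0r => hP [].
- by case=> k ->; rewrite -[UDs k]cats0; apply: regular_UDs; apply: RegularNil.
- case=> l [m [k [k2 ->]]]; apply: regular_UDs.
  case: k k2 => [|[|k]] // _; apply: tail0_regular.
  by apply: (@tail_Us k.+2 0); apply: TailC.
case=> r [k [l [s [r1 kl s1 PE]]]]; case: r r1 kl PE => // r _ kl PE.
(* The path has total height 0, which forces the size of the catastrophe. *)
have sE : s = (\sum_(1 <= i < r.+2) k i + k r.+2)%N.
  move: hP; rewrite PE !height_cat height_bigcat height_C !height_UDs height_Us.
  by rewrite [height [::]]big_nil; lia.
rewrite {}PE {hP} sE; apply: regular_UDs.
have: tail 0 (\big[cat/[::]]_(1 <= i < r.+2) (Us (k i) ++ UDs (l i)) ++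
   Us (k r.+2) ++ [:: C (\sum_(1 <= i < r.+2) k i + k r.+2)] ++ UDs (l r.+2)).
  apply: tail_bigcat; apply: tail_Us; exact: TailC.
rewrite (@big_ltn _ _ _ 1 r.+2) //.
(* As [k 1] and [l 1] are positive, this part begins with [UU]; the second [U] comes from [Us (k 1)]
   or from the first [UD]. *)
have [] := kl 1%N isT; case: (k 1%N) => // k1 _; case: (l 1%N) => // l1 _.
by case: k1 => [|k1]; rewrite ?UsS UDsS -!catA /=; exact: tail0_regular.
Qed.

(** * Regular words belong to [calG] *)

Lemma valid_UDs x m : valid_from (x, 0) (UDs m).
Proof.
elim: m x => // m IHm x; rewrite UDsS /=.
split; first by split=> //; apply: Or31.
by split; [split=> //; apply: Or32|apply: (IHm (x + 1 + 1))].
Qed.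

(** Before the catastrophe the path stays at height at least [h]. Positivity makes the catastrophe
    legal: [C 1] is [D], and a larger one lands on the axis. *)
Lemma tail_valid x h P : (0 < h)%N -> tail h P -> valid_from (x, h%:Z) P.
Proof.
move=> h0 tP; elim: tP x h0 => {h P} [h m|h P _ IH|h P _ IH] x h0.
- have pE : (x, h%:Z) + C h = (x + 1, 0) by congr (_, _); rewrite /= subrr.
  split; last by rewrite pE; apply: valid_UDs.
  split; first by rewrite pE.
  case: h h0 pE => [|[|h]] // _ pE; first exact: Or32.
  by apply: Or33; exists h.+2; rewrite pE.
- split; first by split; [rewrite /=; lia|apply: Or31].
  have -> : (x, h%:Z) + U = (x + 1, h.+1%:Z).
    by congr (_, _); rewrite intS addrC.
  exact: IH.
split; first by split; [rewrite /=; lia|apply: Or31].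
split; first by split; [rewrite /=; lia|apply: Or32].
have -> : (x, h%:Z) + U + D = (x + 1 + 1, h%:Z).
  by congr (_, _); rewrite /= addrK.
exact: IH.
Qed.

Lemma regular_valid x P : regular P -> valid_from (x, 0) P.
Proof.
move=> rP; elim: rP x => {P} [|P _ IH|P tP] x //.
  split; first by split=> //; apply: Or31.
  split; first by split=> //; apply: Or32.
  exact: (IH (x + 1 + 1)).
split; first by split=> //; apply: Or31.
exact: (@tail_valid (x + 1) 1).
Qed.

(** A pair [(a, b)] in [ps] stands for the block [Us a ++ UDs b]. Prepending [U] increments the
    first [a], or [k] if there is no block; prepending [UD] increments [b] if the first [a] is 0,
    and otherwise opens the block [(0, 1)]. Hence only the first [a] can vanish. *)
Lemma tail_shape h P : tail h P -> exists ps k m,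
  [/\ all (fun p => 0 < p.2)%N ps, all (fun p => 0 < p.1)%N (behead ps) &
      P = \big[cat/[::]]_(p <- ps) (Us p.1 ++ UDs p.2) ++
          Us k ++ C (h + \sum_(p <- ps) p.1 + k) :: UDs m].
Proof.
elim=> {h P} [h m|h P _|h P _].
- by exists [::], 0%N, m; rewrite !big_nil !addn0.
- case=> -[|[a b] ps] [k [m [psl psk ->]]].
    by exists [::], k.+1, m; rewrite !big_nil !addn0 addSnnS.
  exists ((a.+1, b) :: ps), k, m; split => //.
  by rewrite !big_cons /= !addSn addnS.
case=> -[|[[|a] b] ps] [k [m [psl psk ->]]].
- by exists [:: (0, 1)%N], k, m; rewrite !big_cons !big_nil.
- exists ((0, b.+1)%N :: ps), k, m; split=> //; last by rewrite !big_cons.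
  by case/andP: psl.
by exists [:: (0, 1)%N, (a.+1, b) & ps], k, m; rewrite !big_cons.
Qed.

Lemma regular_form P : regular P -> [\/ form_i P, form_ii P | form_iii P].
Proof.
elim=> {P} [|P _ IH|P /TailU tP]; first by apply: Or31; exists 0%N.
- case: IH => [[k ->]|[l [m [k [k2 ->]]]]|[r [k [l [s [r1 kl s1 ->]]]]]].
  + by apply: Or31; exists k.+1.
  + by apply: Or32; exists l.+1, m, k.
  apply: Or33; exists r, k, (fun i => if i is 0 then (l 0).+1 else l i)%N, s.
  split=> //; first by case=> // i /kl.
  congr (_ :: _ :: _ ++ (_ ++ _)).
  by apply: eq_big_nat => -[].
have [ps [k [m [psl psk PE]]]] := tail_shape _ _ tP.
case: ps psl psk PE => [|[[|a] [|b]] ps] //= psl psk; last first.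
- rewrite (big_nth (0, 0)%N) [in X in C X](big_nth (0, 0)%N).
  set ps' := (_ :: ps) => PE.
  (* Blocks are numbered from 1 in [form_iii] and from 0 in [ps']; index [(size ps').+1] carries the
     final exponents, and no [UD] precedes the initial [UU]. *)
  pose k' i := if i == (size ps').+1 then k else (nth (0, 0)%N ps' i.-1).1.
  pose l' i := if i == 0%N then 0%N else if i == (size ps').+1 then m else
                 (nth (0, 0)%N ps' i.-1).2.
  apply: Or33; exists (size ps'), k', l'.
  exists (\sum_(0 <= i < size ps') (nth (0, 0)%N ps' i).1 + k)%N.
  split=> //.
  + move=> i /andP[i1 ilt].
    rewrite /k' /l' (gtn_eqF (i1 : 0 < i)%N) (ltn_eqF (ilt : i < _.+1)%N).
    have ps'i : (i.-1 < size ps')%N by lia.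
    split; last first.
      by move: (all_nthP (0, 0)%N (psl : all (fun p => 0 < p.2)%N ps') _ ps'i).
    have: all (fun p => 0 < p.1)%N ps' by rewrite /= psk.
    by move/(all_nthP (0, 0)%N)/(_ _ ps'i).
  + by rewrite big_ltn.
  rewrite PE big_add1 /k' /l' !eqxx /=.
  congr (_ ++ _).
  apply: eq_big_nat => i ilt; rewrite /= eqSS.
  by rewrite (ltn_eqF (ilt : (i < size ps')%N)).
(* A first block with [a = 0] would begin with [UD] instead of [UU]. *)
- by rewrite big_cons /= => -[].
(* Without blocks, the initial [UU] forces [k >= 2]. *)
rewrite !big_nil add0n => PE; apply: Or32; exists 0%N, m, k; split=> //.
case: k PE => [|[|k]] //=.
Qed.

Lemma calGE P : calG P <-> regular P.
Proof.
split; first exact: calG_regular.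
by move=> rP; split; [apply: regular_valid|apply: regular_form].
Qed.

(** * Enumeration by length *)

(** The [nseq] lists the immediate catastrophe exactly when the remaining length is even, as a power
    of [UD] requires. *)
Fixpoint tails (n h : nat) : seq lpath :=
  if n is n'.+1 then
    nseq (~~ odd n') (C h :: UDs n'./2)
    ++ [seq U :: P | P <- tails n' h.+1]
    ++ (if n' is n''.+1 then [seq U :: D :: P | P <- tails n'' h] else [::])
  else [::].

(** Words in [UU] are split by whether the second [U] is a letter or opens a letter [UD]. For
    [n' = 0] the truncated predecessor is harmless, since [tails 0 1] is empty. *)
Fixpoint regulars (n : nat) : seq lpath :=
  match n with
  | 0 => [:: [::]]
  | 1 => [::]
  | n'.+2 => [seq U :: D :: P | P <- regulars n']
             ++ [seq U :: U :: P | P <- tails n' 2]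
             ++ [seq U :: U :: D :: P | P <- tails n'.-1 1]
  end.

Lemma mem_tails n h P : P \in tails n h <-> tail h P /\ size P = n.
Proof.
split=> [|[tP <-]]; last first.
  elim: tP {n} => {h P} [h m|h P _ IH|h P _ IH] /=.
  - by rewrite size_UDs odd_double doubleK mem_head.
  - by rewrite !mem_cat (map_f (cons U) IH) orbT.
  by rewrite !mem_cat (map_f (cons U \o cons D) IH) !orbT.
elim/ltn_ind: n h P => -[|n] IHn h P //=; rewrite !mem_cat => /or3P[].
- rewrite mem_nseq; case: (boolP (odd n)) => //= on /eqP ->.
  split; [exact: TailC | by rewrite /= size_UDs even_halfK].
- by case/mapP=> Q /IHn[] // tQ <- ->; split=> //; apply: TailU.
case: n IHn => // n IHn /mapP[Q /IHn[]] // tQ <- ->.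
by split=> //; apply: TailUD.
Qed.

Lemma mem_regulars n P : P \in regulars n <-> regular P /\ size P = n.
Proof.
split=> [|[rP <-]]; last first.
  elim: rP {n} => {P} [|P _ IH|P tP] //=.
    by rewrite mem_cat (map_f (cons U \o cons D) IH).
  rewrite !mem_cat; inversion tP as [? ? E|? ? tQ|? Q tQ]; subst.
  - have inQ := (mem_tails _ _ _).2 (conj tQ erefl).
    by rewrite (map_f (cons U \o cons U) inQ) orbT.
  have inQ := (mem_tails _ _ _).2 (conj tQ erefl).
  by rewrite (map_f (cons U \o cons U \o cons D) inQ) !orbT.
elim/ltn_ind: n P => -[|[|n]] IHn P //=.
  by rewrite inE => /eqP ->; split=> //; apply: RegularNil.
rewrite !mem_cat => /or3P[] /mapP[Q].
- by case/IHn=> // rQ <- ->; split=> //; apply: RegularUD.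
- by case/mem_tails=> tQ <- ->; split=> //; apply/RegularUU/TailU.
case: n IHn => // n IHn /= /mem_tails[tQ <-] ->; split=> //.
exact/RegularUU/TailUD.
Qed.

(* For [h = 0] the word [UDUD] is listed twice, because [C 1 = D]. *)
Lemma uniq_tails n h : (0 < h)%N -> uniq (tails n h).
Proof.
elim/ltn_ind: n h => -[|n] IHn h h0 //=.
rewrite !cat_uniq; apply/and3P; split.
- by case: (odd n).
- apply/hasPn => P; rewrite mem_cat mem_nseq => UP.
  apply/negP => /andP[_ /eqP PE]; move: UP; rewrite {}PE.
  case/orP; first by case/mapP=> Q _ /(congr1 (head D)) /C_neqU.
  by case: n {IHn} => // n; case/mapP=> Q _ /(congr1 (head D)) /C_neqU.
apply/and3P; split.
- by rewrite map_inj_uniq ?IHn // => ? ? [].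
(* A common word would give a tail from height [h.+1] starting with [D], hence [C h.+1 = D], against
   [0 < h]. *)
- apply/hasPn => P; case: n {IHn} => // n /mapP[Q _ ->].
  apply/negP => /mapP[Q' /mem_tails[tQ' _] [E]]; move: tQ'; rewrite -E => tDQ.
  by inversion tDQ; subst.
case: n IHn => // n IHn.
by rewrite map_inj_uniq ?IHn // => ? ? [].
Qed.

Lemma uniq_regulars n : uniq (regulars n).
Proof.
elim/ltn_ind: n => -[|[|n]] IHn //=.
rewrite !cat_uniq; apply/and3P; split.
- by rewrite map_inj_uniq ?IHn // => ? ? [].
- apply/hasPn => P; rewrite mem_cat => UP.
  apply/negP => /mapP[Q _ PE]; move: UP; rewrite {}PE.
  by case/orP=> /mapP[? _ []].
apply/and3P; split.
- by rewrite map_inj_uniq ?uniq_tails // => ? ? [].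
(* No tail from height 2 starts with [D], because [C 2] differs from [D]. *)
- apply/hasPn => P /mapP[Q _ ->].
  apply/negP => /mapP[Q' /mem_tails[tQ' _] [E]]; move: tQ'; rewrite -E => tDQ.
  inversion tDQ.
by rewrite map_inj_uniq ?uniq_tails // => ? ? [].
Qed.

(** * Counting, recurrences and the generating function *)

Lemma ogf_calG n : ogf calG n = (size (regulars n))%:R.
Proof.
rewrite /ogf -(undup_id (uniq_regulars n)) -card_fseq -[[fset _ in _]%fset]set_fsetK.
congr (#|` fset_set _|%:R); apply/seteqP; split=> P /=.
  by case=> /calGE rP sP; rewrite inE; apply/mem_regulars.
by rewrite inE => /mem_regulars[rP sP]; split=> //; apply/calGE.
Qed.

(** The height enters only the size of the closing catastrophe. *)
Lemma size_tails_height n h h' : size (tails n h) = size (tails n h').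
Proof.
elim/ltn_ind: n h h' => -[|n] IHn h h' //=.
rewrite !size_cat !size_nseq !size_map (IHn n _ h.+1 h'.+1) //.
by case: n IHn => // n IHn; rewrite !size_map (IHn n _ h h').
Qed.

Lemma size_tailsSS n h : size (tails n.+2 h) =
  (odd n + size (tails n.+1 h) + size (tails n h))%N.
Proof.
have -> : tails n.+2 h = nseq (~~ odd n.+1) (C h :: UDs (n.+1)./2) ++
  [seq U :: P | P <- tails n.+1 h.+1] ++ [seq U :: D :: P | P <- tails n h] by [].
rewrite 2!size_cat size_nseq 2!size_map addnA (size_tails_height n.+1 h.+1 h).
by rewrite -[odd n.+1]/(~~ odd n) negbK.
Qed.

Lemma size_regularsSS n : size (regulars n.+2) =
  (size (regulars n) + size (tails n 1) + size (tails n.-1 1))%N.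
Proof. by rewrite /= !size_cat !size_map addnA (size_tails_height n 2 1). Qed.

(** The two instances of the recurrence for tails have equal parity terms, which cancel. Starting at
    [n.+1] keeps every predecessor genuine. *)
Lemma size_regulars_rec n :
  (size (regulars n.+4.+2) + 3 * size (regulars n.+3) =
   2 * size (regulars n.+4.+1) + size (regulars n.+4) + size (regulars n.+1))%N.
Proof.
have := (size_regularsSS n.+4, size_regularsSS n.+3, size_regularsSS n.+1).
have := (size_tailsSS n.+2 1, size_tailsSS n 1).
rewrite ![_.-1]/= ![odd _.+2]/= negbK.
by case=> t4 t2 [[-> ->] ->]; rewrite t4 t2; ring.
Qed.

Lemma ogf_calG_mul :
  fps_mul (ogf calG)
    (fps_of_poly ((1 - 'X^2 - 'X) * (1 - 'X) ^+ 2 * ('X + 1)))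
  = fps_of_poly (2 *: 'X^3 - 2 *: 'X + 1).
Proof.
apply/funext => n; rewrite coef_fps_mul_poly /fps_of_poly.
set a := fps_trunc _ _ _.
(* The denominator is expanded into monomials; writing ['X^1] lets [coefMXn] treat every shift
   alike. *)
have -> : a * ((1 - 'X^2 - 'X) * (1 - 'X) ^+ 2 * ('X + 1)) =
  a - 2 * (a * 'X^1) - a * 'X^2 + 3 * (a * 'X^3) - a * 'X^5 by ring.
have aE i : (i <= n)%N -> a`_i = (size (regulars i))%:R.
  by move=> le_in; rewrite coef_poly ltnS le_in ogf_calG.
rewrite !(coefD, coefN, coefMXn, coefZ, mulr_natl, coefMn, coefXn, coefX, coef1).
rewrite !aE; try lia.
(* The recurrence reaches back from degree 6 on, where the numerator vanishes; the six lower degrees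
   are computed. *)
case: n {a aE} => [|[|[|[|[|[|n]]]]]]; [by vm_compute.. | idtac].
have /(congr1 (fun m => m%:R : rat)) := size_regulars_rec n.
rewrite 3!natrD 2!natrM !subSS !subn0.
move: (size _) (size _) (size _) (size _) (size _) => r6 r3 r5 r4 r1 /=.
by move/(canRL (addrK _)) => ->; rewrite !mul0rn; ring.
Qed.

Theorem theorem3p4 :
  ogf calG =
    fps_div (fps_of_poly (2 *: 'X^3 - 2 *: 'X + 1))
            (fps_of_poly ((1 - 'X^2 - 'X) * (1 - 'X) ^+ 2 * ('X + 1)))
  /\
  fps_eq_bigO 12 (ogf calG)
    (fps_of_poly (1 + 'X^2 + 'X^3 + 3 *: 'X^4 + 5 *: 'X^5 + 10 *: 'X^6
                  + 17 *: 'X^7 + 30 *: 'X^8 + 50 *: 'X^9 + 84 *: 'X^10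
                  + 138 *: 'X^11)).
Proof.
split.
  apply: fps_divP ogf_calG_mul.
  (* The denominator has constant term 1. *)
  by rewrite /fps_of_poly -horner_coef0 !hornerE.
(* The expansion is checked by evaluating the lengths of the enumerations, not by dividing
   series. *)
move=> i lt_i12; rewrite ogf_calG /fps_of_poly !(coefD, coefZ, coefXn, coef1).
by do 12?[case: i lt_i12 => [|i] lt_i12; first by vm_compute].
Qed.
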